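(* Let $X, Y$ be non-zero ordered normed spaces with the following properties: (1) The cone $X_+$ is total, there exists an equivalent norm on $X$ that is additive on $X_+$, and every extremal vector of $X_+$ is also extremal in the bidual cone $X''_+$ (where $X$ is identified with its canonical image in $X''$). Moreover, the convex hull of the extremal vectors in $X_+$ is dense in $X_+$. (2) The cone $Y_+$ has non-empty interior. Then there is no pair of non-zero disjoint elements in $\mathcal{C}(X,Y)$ if and only if there is no pair of non-zero disjoint elements in $X'$ and no pair of non-zero disjoint elements in $Y$.
   Context: All vector spaces are real. A wedge in a real vector space $V$ is a non-empty subset $V_+$ with $\alpha V_+ + \beta V_+ \subseteq V_+$ for all real $\alpha,\beta \ge 0$; it is a cone if in addition $V_+ \cap (-V_+) = \{0\}$. One writes $x \le y$ if $y - x \in V_+$, and $[v_1,v_2] = \{x \in V : v_1 \le x \le v_2\}$. A vector $v \in V_+$ is called extremal in $V_+$ (an extremal vector of $V_+$) if all elements of $[0,v]$ are scalar multiples of $v$. An ordered normed space is a normed space $X$ (not necessarily complete) endowed with a norm closed cone $X_+$. The cone $X_+$ is total if its linear span is norm dense in $X$. A norm on $X$ is additive on $X_+$ if $\|x_1+x_2\| = \|x_1\|+\|x_2\|$ for all $x_1,x_2\in X_+$. The norm dual $X'$ is endowed with the dual wedge $X'_+ = \{x' \in X' : \langle x', x\rangle \ge 0 \text{ for all } x \in X_+\}$; the bidual $X''$ is endowed with $X''_+ = \{x'' \in X'' : \langle x'', x'\rangle \ge 0 \text{ for all } x' \in X'_+\}$. $\mathcal{L}(X,Y)$ is the space of bounded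 linear operators from $X$ to $Y$ with the operator norm, and $\mathcal{L}(X,Y)_+ = \{T \in \mathcal{L}(X,Y): T[X_+] \subseteq Y_+\}$. $\mathcal{C}(X,Y)$ is the operator norm closure in $\mathcal{L}(X,Y)$ of the subspace of bounded finite rank operators, ordered by $\mathcal{C}(X,Y)_+ = \mathcal{C}(X,Y) \cap \mathcal{L}(X,Y)_+$. A vector lattice cover of an ordered vector space $V$ is a vector lattice $W$ with a bipositive linear map $\Phi : V\to W$ (i.e. $v\ge 0 \iff \Phi(v)\ge 0$) such that each $w\in W$ is the infimum of $\{u\in\Phi[V] : u\ge w\}$; $V$ is a pre-Riesz space if it has a vector lattice cover (every ordered normed space with generating cone is one). Two elements $v_1, v_2$ (not necessarily positive) of a pre-Riesz space $V$ are disjoint if the sets $\{v_1+v_2, -v_1-v_2\}$ and $\{v_1-v_2, v_2-v_1\}$ have the same upper bounds in $V$. A pair of non-zero disjoint elements means disjoint $v_1,v_2$ with both $v_1 \neq 0$ and $v_2 \ne 0$. *)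

(* Defs.v *)
From HB Require Import structures.
From mathcomp Require Import all_boot all_order all_algebra.
From mathcomp Require Import all_classical all_reals all_analysis.
Set Implicit Arguments.
Unset Strict Implicit.
Unset Printing Implicit Defensive.
Import Order.TTheory GRing.Theory Num.Theory.
Import numFieldNormedType.Exports.
Local Open Scope classical_set_scope.
Local Open Scope ring_scope.

(** A (pre)ordered vector space is an [lmodType] [V] together with the set
    [K : set V] of its positive elements; [x <= y] reads [K (y - x)]. *)
Section ordered_vector_spaces.
Context {R : realType} {V : lmodType R}.
Implicit Types (K A : set V) (u v : V).

Definition is_wedge K :=
  K !=set0 /\
  forall (a b : R) u v, 0 <= a -> 0 <= b -> K u -> K v -> K (a *: u + b *: v).

Definition is_cone K := is_wedge K /\ K `&` [set v | K (- v)] = [set 0].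

Definition order_interval K u v := [set x | K (x - u) /\ K (v - x)].

Definition extremal K v :=
  K v /\ order_interval K 0 v `<=` [set a *: v | a in [set: R]].

Definition upper_bounds K A := [set u | forall a, A a -> K (u - a)].

(** Disjointness in the pre-Riesz sense: [u] and [v] need not be positive, and
    upper bounds range over all of [V]. *)
Definition disjoint_elements K u v :=
  upper_bounds K [set u + v; - u - v] = upper_bounds K [set u - v; v - u].

Definition has_nonzero_disjoint_pair K :=
  exists u v, [/\ u != 0, v != 0 & disjoint_elements K u v].

Definition linear_span A := [set v | exists n (a : 'I_n -> R) (u : 'I_n -> V),
  (forall i, A (u i)) /\ v = \sum_(i < n) a i *: u i].

Definition convex_hull A : set V := smallest (@convex_set R V) A.

End ordered_vector_spaces.

Section norms.
Context {R : realType}.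

Definition is_norm (V : lmodType R) (N : V -> R) :=
  [/\ forall u v, N (u + v) <= N u + N v,
      forall (a : R) v, N (a *: v) = `|a| * N v &
      forall v, N v = 0 -> v = 0].

Definition equivalent_norm (V : normedModType R) (N : V -> R) :=
  exists c C : R, [/\ 0 < c, 0 < C &
    forall v, c * `|v| <= N v /\ N v <= C * `|v|].

Definition norm_additive_on (V : lmodType R) (K : set V) (N : V -> R) :=
  forall u v, K u -> K v -> N (u + v) = N u + N v.

End norms.

Definition is_ordered_normed_space (R : realType) (X : normedModType R)
  (K : set X) := is_cone K /\ closed K.

Definition total_cone (R : realType) (X : normedModType R) (K : set X) :=
  dense (linear_span K).

Section bounded_operators.
Context {R : realType} (X Y : normedModType R).

Definition bounded_linear (f : X -> Y) :=
  linear f /\ exists M : R, forall x, `|f x| <= M * `|x|.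

Definition bounded_linear_pred : {pred X -> Y} :=
  [pred f | `[< bounded_linear f >]].

Fact bounded_linear_submod_closed : submod_closed bounded_linear_pred.
Proof.
split; first by apply/asboolP; split=> [a u v|];
  [rewrite scaler0 addr0 | exists 0 => x; rewrite normr0 mul0r].
move=> a f g /asboolP[fl [M fM]] /asboolP[gl [N gN]]; apply/asboolP; split.
  move=> k u v; rewrite !fctE fl gl !scalerDr !scalerA (mulrC a k).
  by rewrite -!addrA; congr (_ + _); rewrite addrCA.
exists (`|a| * M + N) => x; rewrite !fctE mulrDl.
apply: (le_trans (ler_normD _ _)); apply: lerD (gN x).
by rewrite normrZ -mulrA ler_wpM2l.
Qed.

HB.instance Definition _ :=
  GRing.isSubmodClosed.Build R (X -> Y) bounded_linear_pred
    bounded_linear_submod_closed.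

Record boundedOp := BoundedOp {
  boundedOp_fun : X -> Y;
  boundedOp_bounded_linear : boundedOp_fun \in bounded_linear_pred }.

HB.instance Definition _ := [isSub for boundedOp_fun].
HB.instance Definition _ := [Choice of boundedOp by <:].
HB.instance Definition _ := [SubChoice_isSubLmodule of boundedOp by <:].

End bounded_operators.

Coercion boundedOp_fun : boundedOp >-> Funclass.

Section operator_norm.
Context {R : realType} {X Y : normedModType R}.
Implicit Types S T : boundedOp X Y.

Lemma boundedOp_linear T : linear T.
Proof. by have /asboolP[] := boundedOp_bounded_linear T. Qed.

HB.instance Definition _ T :=
  GRing.isLinear.Build R X Y _ (boundedOp_fun T) (boundedOp_linear T).

Definition opnorm T : R := sup [set `|T x| | x in [set x | `|x| <= 1]].

Let opnorm_has_sup T : has_sup [set `|T x| | x in [set x | `|x| <= 1]].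
Proof.
split; first by exists `|T 0|, 0 => //=; rewrite normr0.
have /asboolP[_ [M TM]] := boundedOp_bounded_linear T.
exists `|M| => _ [x /= x1 <-]; apply: (le_trans (TM x)).
apply: (le_trans (ler_norm _)); rewrite normrM normr_id.
by rewrite ler_piMr.
Qed.

Lemma opnormP T x : `|T x| <= opnorm T * `|x|.
Proof.
have [->|x0] := eqVneq x 0; first by rewrite linear0 !normr0 mulr0.
have x0' : 0 < `|x| by rewrite normr_gt0.
rewrite -ler_pdivrMr // mulrC -[X in X * _]gtr0_norm ?invr_gt0// -normrZ.
rewrite -linearZ; apply: ub_le_sup; first exact: (opnorm_has_sup T).2.
by exists (`|x|^-1 *: x) => //=; rewrite normrZ normfV normr_id mulVf ?gt_eqF.
Qed.

Lemma opnorm_le T (M : R) :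
  0 <= M -> (forall x, `|T x| <= M * `|x|) -> opnorm T <= M.
Proof.
move=> M0 TM; apply: ge_sup; first exact: (opnorm_has_sup T).1.
by move=> _ [x /= x1 <-]; apply: (le_trans (TM x)); rewrite ler_piMr.
Qed.

Lemma opnorm_ge0 T : 0 <= opnorm T.
Proof.
apply: (@le_trans _ _ `|T 0|); first exact: normr_ge0.
apply: ub_le_sup; first exact: (opnorm_has_sup T).2.
by exists 0 => //=; rewrite normr0.
Qed.

Fact ler_opnormD S T : opnorm (S + T) <= opnorm S + opnorm T.
Proof.
apply: opnorm_le => [|x]; first by rewrite addr_ge0 ?opnorm_ge0.
by rewrite mulrDl; apply: (le_trans (ler_normD _ _)); apply: lerD; exact: opnormP.
Qed.

Fact opnormZ (a : R) T : opnorm (a *: T) = `|a| * opnorm T.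
Proof.
have le (b : R) S : opnorm (b *: S) <= `|b| * opnorm S.
  apply: opnorm_le => [|x]; first by rewrite mulr_ge0 ?opnorm_ge0.
  by rewrite -mulrA /= normrZ ler_wpM2l// opnormP.
have [->|a0] := eqVneq a 0.
  rewrite normr0 mul0r; apply/eqP; rewrite eq_le opnorm_ge0 andbT.
  by apply: (le_trans (le _ _)); rewrite normr0 mul0r.
apply/eqP; rewrite eq_le le -ler_pdivlMl ?normr_gt0//=.
by rewrite -normfV; apply: le_trans (le _ _); rewrite scalerA mulVf// scale1r.
Qed.

Fact opnorm_eq0 T : opnorm T = 0 -> T = 0.
Proof.
move=> T0; apply/val_inj/funext => x; apply/eqP; rewrite -normr_le0.
by rewrite (le_trans (opnormP T x))// T0 mul0r.
Qed.

HB.instance Definition _ :=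
  @Lmodule_isNormed.Build R (boundedOp X Y)
    opnorm ler_opnormD opnormZ opnorm_eq0.

End operator_norm.

Definition positive_operators (R : realType) (X Y : normedModType R)
    (Xp : set X) (Yp : set Y) : set (boundedOp X Y) :=
  [set T | T @` Xp `<=` Yp].

Definition dual_space (R : realType) (X : normedModType R) : normedModType R :=
  boundedOp X R^o.

Definition dual_wedge (R : realType) (X : normedModType R) (Xp : set X) :
    set (dual_space X) :=
  [set x' : boundedOp X R^o | forall x, Xp x -> 0 <= x' x].

Section bidual_embedding.
Context {R : realType} {X : normedModType R}.

Fact eval_bounded_linear (x : X) :
  (fun x' : boundedOp X R^o => x' x)
    \in @bounded_linear_pred R (dual_space X) R^o.
Proof.
apply/asboolP; split=> [//|]; exists `|x| => x'.
by rewrite mulrC; exact: opnormP.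
Qed.

Definition bidual_embedding (x : X) : dual_space (dual_space X) :=
  BoundedOp (eval_bounded_linear x).

End bidual_embedding.

Section finite_rank_closure.
Context {R : realType} (X Y : normedModType R).

Definition finite_rank : set (boundedOp X Y) :=
  [set T | exists B : set Y, finite_set B /\ range T `<=` linear_span B].

Definition approximable_pred : {pred boundedOp X Y} :=
  [pred T | T \in closure finite_rank].

Let finite_rank0 : finite_rank 0.
Proof.
exists set0; split=> // _ [x _ <-]; exists 0, (fun=> 0), (fun=> 0).
by split=> [[]//|]; rewrite big_ord0.
Qed.

Let finite_rankP (a : R) S T :
  finite_rank S -> finite_rank T -> finite_rank (a *: S + T).
Proof.
move=> [B [fB SB]] [C [fC TC]]; exists (B `|` C); split.
  by rewrite finite_setU.
move=> _ [x _ <-].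
have [n [b [u [uB Sx]]]] := SB _ (imageT S x).
have [m [c [v [vC Tx]]]] := TC _ (imageT T x).
exists (n + m)%N,
  (fun i => match fintype.split i with inl j => a * b j | inr j => c j end),
  (fun i => match fintype.split i with inl j => u j | inr j => v j end).
split; first by move=> i; case: fintype.split => j; [left|right].
rewrite big_split_ord/= -[LHS]/(a *: S x + T x) Sx Tx scaler_sumr.
congr (_ + _); apply: eq_bigr => i _.
  by rewrite (unsplitK (inl i)) scalerA.
by rewrite (unsplitK (inr i)).
Qed.

Let closureP (T : boundedOp X Y) : closure finite_rank T <->
  forall e : R, 0 < e -> exists2 S, finite_rank S & `|T - S| < e.
Proof.
split=> [cT e e0|cT B /nbhs_ballP[e /= e0 eB]].
  have [S [fS]] := cT _ (nbhsx_ballx T e e0).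
  by rewrite -ball_normE /= => TS; exists S.
have [S fS TS] := cT _ e0; exists S; split=> //.
by apply: eB; rewrite -ball_normE.
Qed.

Fact approximable_submod_closed : submod_closed approximable_pred.
Proof.
split; first by rewrite !inE; exact: subset_closure.
move=> a S T; rewrite !inE => /closureP cS /closureP cT; apply/closureP => e e0.
have a0 : 0 < `|a| + 1 by rewrite ltr_wpDl.
have [S' fS' SS'] := cS (e / 2 / (`|a| + 1)) ltac:(by rewrite !divr_gt0).
have [T' fT' TT'] := cT (e / 2) ltac:(by rewrite divr_gt0).
exists (a *: S' + T'); first exact: finite_rankP.
rewrite opprD addrACA -scalerBr (splitr e).
apply: (le_lt_trans (ler_normD _ _)); apply: ler_ltD => //.
rewrite normrZ; move: SS'; rewrite ltr_pdivlMr// mulrDr mulr1 mulrC => SS'.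
by apply: (le_trans _ (ltW SS')); rewrite lerDl.
Qed.

HB.instance Definition _ :=
  GRing.isSubmodClosed.Build R (boundedOp X Y) approximable_pred
    approximable_submod_closed.

(** The operator norm closure of the bounded finite rank operators. It is a type
    of its own so that the upper bounds that define disjointness of two of its
    elements range over this space only. *)
Record approximableOp := ApproximableOp {
  approximableOp_val : boundedOp X Y;
  approximableOp_closure : approximableOp_val \in approximable_pred }.

HB.instance Definition _ := [isSub for approximableOp_val].
HB.instance Definition _ := [Choice of approximableOp by <:].
HB.instance Definition _ := [SubChoice_isSubLmodule of approximableOp by <:].

End finite_rank_closure.

Definition positive_approximable_operators (R : realType) (X Y : normedModType R)
    (Xp : set X) (Yp : set Y) : set (approximableOp X Y) :=
  [set T | positive_operators Xp Yp (approximableOp_val T)].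

(* Main.v *)
Require Import Defs.
From HB Require Import structures.
From mathcomp Require Import all_boot all_order all_algebra.
From mathcomp Require Import all_classical all_reals all_analysis.
From mathcomp Require Import ring lra.
Import Order.TTheory GRing.Theory Num.Theory.
Import numFieldNormedType.Exports.
Local Open Scope classical_set_scope.
Local Open Scope ring_scope.

(** One direction is soft. If f1, f2 are disjoint in X' then the rank one
    operators f1 (x) e and f2 (x) e are disjoint, because positivity of an
    operator can be tested after composing it with the positive functionals
    of Y, and a disjoint pair stays disjoint after scaling
    ([tensor_disjointl]); if y1, y2 are disjoint in Y, the same holds for
    phi (x) y1 and phi (x) y2, now testing pointwise ([tensor_disjointr]).

    For the other direction let S, T be disjoint operators. The crux is that
    S x and T x are disjoint in Y whenever x is extremal in the bidual cone
    ([disjoint_at_extremal]). So let w be an upper bound of S x + T x and its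
    negative. One needs an operator U above S + T and above its negative whose
    value at x is almost below w: then U is above S - T and T - S by
    disjointness, and evaluating at x gives the same for w. Such a U exists
    by Hahn-Banach ([extremal_interpolation]). If there were none, a
    separating functional would produce a positive functional g on operators
    dominated by U |-> h (U x) for some functional h on Y
    ([interpolation_duality]). For fixed v >= 0 the functional
    f |-> g (f (x) v) lies in X'' and below a multiple of x, so by
    extremality it is a multiple of x; hence g U = l (U x) for a functional l
    with 0 <= l <= h ([extremal_splitting]), first for rank one operators,
    then for finite rank operators, then for their limits, since a positive
    functional is bounded in presence of the order unit phi (x) e. Evaluating
    the separating functional with this formula contradicts that w is an
    upper bound.

    If Y has no non-zero disjoint pair, then at each extremal x one of S x and
    T x vanishes. Hence for functionals y1', y2' on Y the functionals y1' S
    and y2' T never are both non-zero at an extremal vector, so sum and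
    difference have the same absolute value there; as the extremal vectors
    determine the order of X', these functionals are disjoint
    ([disjoint_of_vanishing_on_extremals]), although y1' and y2' are
    unrelated. If S and T are non-zero, y1' and y2' can be chosen so that both
    compositions are non-zero, and X' has a non-zero disjoint pair.

    Two normalisations are used throughout: e in the interior of the cone of Y
    is scaled so that v <= |v| e for all v ([norm_order_unit]), and phi is a
    functional on X with |x| <= phi x on the cone of X
    ([strictly_positive_functional]). *)

(** * Hahn-Banach for convex cones *)

Section hahn_banach.
Context {R : realType} {V : lmodType R}.
Implicit Types (E A : set (V * R)) (v w : V) (s t a : R).

(** The cones below which a linear functional is sought:
    the infimum of the t with E (v, t) is a sublinear functional of v, and all
    the sublinear functionals of this development arise in this way. Working
    with the cone avoids computing these infima. *)
Definition epigraph_cone E :=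
  [/\ E (0, 0),
      forall v w s t, E (v, s) -> E (w, t) -> E (v + w, s + t),
      forall a v s, 0 < a -> E (v, s) -> E (a *: v, a * s) &
      forall t, E (0, t) -> 0 <= t].

Definition adjoin_ray E v0 t0 : set (V * R) :=
  [set p | E p \/ exists a w s,
    [/\ 0 < a, E (w, s) & p = (w + a *: v0, s + a * t0)]].

Lemma adjoin_ray_mem E v0 t0 : epigraph_cone E -> adjoin_ray E v0 t0 (v0, t0).
Proof.
move=> [E00 _ _ _]; right; exists 1, 0, 0.
by rewrite ltr01 scale1r mul1r !add0r.
Qed.

(** A point of the ray returns to the fibre over 0 only when combined with an
    element of E over a multiple of [- v0], so the last condition of an
    epigraph cone reduces to the stated one. *)
Lemma adjoin_ray_epigraph_cone E v0 t0 : epigraph_cone E ->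
  (forall s, E (- v0, s) -> 0 <= s + t0) -> epigraph_cone (adjoin_ray E v0 t0).
Proof.
move=> [E00 Eadd Escale E0] Et0; split; first by left.
- move=> v w s t [Ev|[a [v' [s' [a0 Ev [-> ->]]]]]].
  + move=> [Ew|[b [w' [t' [b0 Ew [-> ->]]]]]]; first by left; exact: Eadd.
    right; exists b, (v + w'), (s + t'); split=> //; first exact: Eadd.
    by rewrite !addrA.
  + move=> [Ew|[b [w' [t' [b0 Ew [-> ->]]]]]].
      right; exists a, (v' + w), (s' + t); split=> //; first exact: Eadd.
      by congr (_, _); rewrite addrAC.
    right; exists (a + b), (v' + w'), (s' + t'); split; first exact: addr_gt0.
      exact: Eadd.
    by rewrite addrACA -scalerDl addrACA -mulrDl.
- move=> b v s b0 [Ev|[a [w [t [a0 Ew [-> ->]]]]]]; first by left; exact: Escale.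
  right; exists (b * a), (b *: w), (b * t); split; first exact: mulr_gt0.
    exact: Escale.
  by rewrite scalerDr scalerA mulrDr mulrA.
- move=> t [/E0//|[a [w [s [a0 Ew [w0 ->]]]]]].
  have /Et0 : E (- v0, a^-1 * s).
    have -> : - v0 = a^-1 *: w.
      rewrite -[w]addr0 -(subrr (a *: v0)) addrA -w0 sub0r scalerN scalerA.
      by rewrite mulVf ?gt_eqF// scale1r.
    by apply: Escale => //; rewrite invr_gt0.
  by rewrite -(pmulr_rge0 _ a0) mulrDr mulrA divff ?gt_eqF// mul1r.
Qed.

(** Maximality makes the last alternative hold: a point (v, t) whose ray cannot be
    adjoined has an obstruction over [- v]. So a maximal cone is the epigraph
    of a functional that is odd, hence linear. *)
Lemma maximal_epigraph_cone E : epigraph_cone E -> exists F,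
  [/\ epigraph_cone F, E `<=` F &
      forall v t, F (v, t) \/ exists2 s, s + t < 0 & F (- v, s)].
Proof.
move=> Econe.
(* The union with E in P makes P hold of the union of the empty chain. *)
pose P A := epigraph_cone (E `|` A).
have [F FP totF|A [PA Amax]] := @Zorn_bigcup _ P.
  have [E00 Eadd Escale E0] := Econe; split; first by left.
  - move=> v w s t Hv Hw.
    suff [A [Av Aw AP]] : exists A, [/\ (E `|` A) (v, s), (E `|` A) (w, t) &
        A = set0 \/ F A].
      have [A0|FA] := AP.
        by move: Av Aw; rewrite A0 setU0 => Av Aw; left; exact: Eadd.
      have [_ Aadd _ _] := FP _ FA.
      by case: (Aadd _ _ _ _ Av Aw) => [?|?]; [left|right; exists A].
    case: Hv Hw => [Ev|[A FA Av]] [Ew|[B FB Bw]].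
    + by exists set0; split; left.
    + by exists B; split; [left|right|right].
    + by exists A; split; [right|left|right].
    + have [AB|BA] := totF _ _ FA FB.
        by exists B; split; [right; exact: AB|right|right].
      by exists A; split; [right|right; exact: BA|right].
  - move=> a v s a0 [Ev|[A FA Av]]; first by left; exact: Escale.
    have [_ _ Ascale _] := FP _ FA.
    by case: (Ascale a v s a0 (or_intror Av)) => ?; [left|right; exists A].
  - move=> t [/E0//|[A FA At]]; have [_ _ _] := FP _ FA; apply; by right.
exists (E `|` A); split=> [|p Ep|v t]; [exact: PA|by left|].
apply: contrapT => /not_orP[nvt nex].
set B := adjoin_ray (E `|` A) v t.
have EAB : E `|` A `<=` B by move=> p Ap; left.
have Bvt : B (v, t) by exact: adjoin_ray_mem.
apply: (Amax B); first split.
- by move=> p Ap; apply: EAB; right.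
- by move=> BA; apply: nvt; right; exact: BA.
- rewrite /P; have -> : E `|` B = B.
    by apply/setUidr => p Ep; apply: EAB; left.
  apply: adjoin_ray_epigraph_cone => // s As; rewrite leNgt; apply/negP => st.
  by apply: nex; exists s.
Qed.

Theorem hahn_banach E : epigraph_cone E -> (forall v, exists t, E (v, t)) ->
  exists g : {linear V -> R^o}, forall v t, E (v, t) -> g v <= t.
Proof.
move=> Econe Etot.
(* The functional is the lower boundary of a maximal cone. *)
have [F [[F00 Fadd Fscale F0] EF Fhalf]] := maximal_epigraph_cone _ Econe.
pose H v := [set t | F (v, t)].
have Hlb v s t : F (v, s) -> F (- v, t) -> 0 <= s + t.
  by move=> Fv Fw; apply: F0; rewrite -(subrr v); exact: Fadd.
have Hinf v : has_inf (H v).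
  have [s Es] := Etot (- v); have [t Et] := Etot v.
  split; first by exists t; exact: EF.
  by exists (- s) => r Fr; rewrite lerNl -subr_ge0 opprK addrC (Hlb v)//; exact: EF.
pose g v := inf (H v).
have gle v t : F (v, t) -> g v <= t.
  by move=> Fv; apply: ge_inf => //; exact: (Hinf v).2.
have leg v c : (forall t, F (v, t) -> c <= t) -> c <= g v.
  by move=> cF; apply: lb_le_inf => //; exact: (Hinf v).1.
have gN v : g (- v) = - g v.
  apply/eqP; rewrite eq_le; apply/andP; split; last first.
    apply: (leg) => t Ft; rewrite lerNl; apply: leg => s Fs.
    by rewrite -subr_ge0 opprK (Hlb v).
  rewrite leNgt; apply/negP => gv.
  (* Maximality at the midpoint excludes a gap between g (- v) and - g v. *)
  have [/gle|[s st /gle]] := Fhalf v ((g v - g (- v)) / 2); lra.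
have gD v w : g (v + w) = g v + g w.
  have gDle v' w' : g (v' + w') <= g v' + g w'.
    rewrite -lerBlDr; apply: (leg) => s Fs; rewrite lerBlDl -lerBlDr.
    apply: leg => t Ft; rewrite lerBlDl; apply: gle.
    exact: Fadd.
  apply/eqP; rewrite eq_le gDle/=.
  by have := gDle (v + w) (- w); rewrite addrK gN -lerBlDr opprK.
have gZ a v : g (a *: v) = a * g v.
  have gZle b w : 0 < b -> g (b *: w) <= b * g w.
    move=> b0; rewrite -ler_pdivrMl//; apply: leg => t Ft.
    by rewrite ler_pdivrMl//; apply: gle; exact: Fscale.
  have gZp b w : 0 < b -> g (b *: w) = b * g w.
    move=> b0; apply/eqP; rewrite eq_le gZle//= -ler_pdivlMl//.
    have := gZle b^-1 (b *: w); rewrite invr_gt0 => /(_ b0).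
    by rewrite scalerA mulVf ?gt_eqF// scale1r.
  have [a0|a0|->] := ltgtP a 0; last 2 first.
  - exact: gZp.
  - have := gN 0; rewrite scale0r oppr0 mul0r; move: (g 0) => b; lra.
  by rewrite -[a in LHS]opprK scaleNr gN gZp ?oppr_gt0// mulNr opprK.
have glin : linear (g : V -> R^o) by move=> a v w; rewrite gD gZ.
exists (HB.pack_for {linear V -> R^o} (g : V -> R^o)
  (GRing.isLinear.Build R V R^o _ _ glin)).
by move=> v t /EF; exact: gle.
Qed.

(** Adjoining the ray through [(- v0, - c)] forces the value at v0 to be at least
    c; the bound on E over v0 is exactly what this adjunction needs. *)
Corollary hahn_banach_lt E v0 c : epigraph_cone E ->
  (forall v, exists t, E (v, t)) -> (forall t, E (v0, t) -> c <= t) ->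
  exists g : {linear V -> R^o},
    (forall v t, E (v, t) -> g v <= t) /\ c <= g v0.
Proof.
move=> Econe Etot Ec.
have Fcone : epigraph_cone (adjoin_ray E (- v0) (- c)).
  apply: adjoin_ray_epigraph_cone => // s; rewrite opprK => /Ec; lra.
have [|g gF] := hahn_banach _ Fcone.
  by move=> v; have [t Et] := Etot v; exists t; left.
exists g; split=> [v t Et|]; first by apply: gF; left.
by rewrite -lerN2 -linearN; apply: gF; exact: adjoin_ray_mem.
Qed.

End hahn_banach.

(** * Wedges and disjoint elements *)

Section cones.
Context {R : realType} {V : lmodType R} {K : set V}.
Implicit Types (u v w : V) (a : R).

(** The two elements of each set are opposite, and this symmetric form is the one
    that is stable under evaluation and composition. *)
Lemma disjointP u v : disjoint_elements K u v <->
  forall w, K (w - (u + v)) /\ K (w + (u + v)) <->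
            K (w - (u - v)) /\ K (w + (u - v)).
Proof.
have ubE v1 v2 w : upper_bounds K [set v1; v2] w <-> K (w - v1) /\ K (w - v2).
  by split=> [wK|[w1 w2] _ [->|->]//]; split; apply: wK; [left|right].
have uvN : - u - v = - (u + v) by rewrite opprD.
split=> [uv w|uv].
  have := ubE (u + v) (- u - v) w; have := ubE (u - v) (v - u) w.
  by rewrite uv uvN -[v - u]opprB !opprK => -> <-.
apply/seteqP; split=> w /ubE wK; apply/ubE; move: wK;
  by rewrite uvN -[v - u]opprB !opprK => /uv.
Qed.

(** Replacing v by [- v] exchanges the two sets of upper bounds, so one inclusion
    proved for both signs suffices. *)
Lemma disjoint_sub u v :
  (forall v' w, v' = v \/ v' = - v -> K (w - (u + v')) -> K (w + (u + v')) ->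
     K (w - (u - v')) /\ K (w + (u - v'))) ->
  disjoint_elements K u v.
Proof.
move=> uv; apply/disjointP => w; split=> -[Kw1 Kw2].
  by apply: (uv v w) => //; left.
by have := uv (- v) w; rewrite opprK; apply => //; right.
Qed.

Lemma wedgeD u v : is_wedge K -> K u -> K v -> K (u + v).
Proof.
by move=> [_ KD] Ku Kv; rewrite -[u]scale1r -[v]scale1r; exact: KD.
Qed.

Lemma wedgeZ a u : is_wedge K -> 0 <= a -> K u -> K (a *: u).
Proof.
by move=> [_ KD] a0 Ku; rewrite -[_ *: _]addr0 -(scale0r u); exact: KD.
Qed.

Lemma wedge0 : is_wedge K -> K 0.
Proof. by move=> wK; have [[u Ku] _] := wK; rewrite -(scale0r u); exact: wedgeZ. Qed.

Lemma wedge_scale_inv a u : is_wedge K -> 0 < a -> K (a *: u) -> K u.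
Proof.
move=> wK a0 Kau; rewrite -[u]scale1r -(@mulVf _ a) ?gt_eqF// -scalerA.
by apply: wedgeZ => //; rewrite invr_ge0 ltW.
Qed.

Lemma disjointZ a u v : is_wedge K ->
  disjoint_elements K u v -> disjoint_elements K (a *: u) (a *: v).
Proof.
move=> wK /disjointP uv; apply/disjointP => w; rewrite -scalerDr -scalerBr.
have [->|a0] := eqVneq a 0; first by rewrite !scale0r.
have na0 : 0 < `|a| by rewrite normr_gt0.
have absE s : K (w - a *: s) /\ K (w + a *: s) <->
    K (w - `|a| *: s) /\ K (w + `|a| *: s).
  by have [_|_] := ger0P a; rewrite // scaleNr opprK; split=> -[].
have scaleE s : K (w + `|a| *: s) <-> K (`|a|^-1 *: w + s).
  have -> : w + `|a| *: s = `|a| *: (`|a|^-1 *: w + s).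
    by rewrite scalerDr scalerA divff ?gt_eqF// scale1r.
  by split=> [/wedge_scale_inv|/wedgeZ]; apply=> //; exact: ltW.
rewrite !absE -!scalerN !scaleE; exact: uv.
Qed.

Lemma cone_anti u : is_cone K -> K u -> K (- u) -> u = 0.
Proof. by move=> [_ KK] Ku KNu; have : [set 0] u by rewrite -KK. Qed.

Lemma cone_scale_ge0 t u : is_cone K -> K u -> u != 0 -> K (t *: u) -> 0 <= t.
Proof.
move=> coneK Ku u0 Kt; rewrite leNgt; apply/negP => t0.
apply/negP: u0; rewrite negbK; apply/eqP; apply: cone_anti => //.
apply: (@wedge_scale_inv (- t)); [exact: coneK.1|by rewrite oppr_gt0|].
by rewrite scaleNr scalerN opprK.
Qed.

End cones.

(** * Positive functionals on ordered normed spaces *)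

Section functionals.
Context {R : realType}.

Lemma dominated_bounded (X : normedModType R) (g : {linear X -> R^o}) (M : R) :
  (forall x, g x <= M * `|x|) -> (g : X -> R^o) \in @bounded_linear_pred R X R^o.
Proof.
move=> gM; apply/asboolP; split; first exact: linearP.
exists M => x; rewrite ler_norml gM andbT lerNl.
have /= := gM (- x); by rewrite linearN normrN.
Qed.

Definition op_of_dominated (X : normedModType R) (g : {linear X -> R^o})
  (M : R) (gM : forall x, g x <= M * `|x|) : boundedOp X R^o :=
  BoundedOp (dominated_bounded X g M gM).

(** An interior point e0 of the cone dominates all vectors of norm less than r; rescaling it
    by 2 / r gives a unit for the norm itself. *)
Lemma norm_order_unit (Y : normedModType R) (Yp : set Y) :
  is_wedge Yp -> interior Yp !=set0 ->
  exists2 e, Yp e & forall v, Yp (`|v| *: e - v).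
Proof.
move=> wedgeY [e0 /nbhs_ballP[r /= r0 rY]].
have unit v : Yp (`|v| *: ((2 / r) *: e0) - v).
  have [->|v0] := eqVneq v 0; first by rewrite normr0 scale0r subr0; exact: wedge0.
  have v0' : 0 < `|v| by rewrite normr_gt0.
  have a0 : 0 < r / 2 / `|v| by rewrite !divr_gt0.
  apply: (wedge_scale_inv _ _ wedgeY a0).
  rewrite scalerBr !scalerA [X in X *: e0](_ : _ = 1); last first.
    by field; rewrite !gt_eqF.
  rewrite scale1r; apply: rY.
  rewrite -ball_normE /= opprB addrC subrK normrZ gtr0_norm// divfK ?gt_eqF//.
  by rewrite ltr_pdivrMr// mulr_natr mulr2n ltrDl.
exists ((2 / r) *: e0) => //.
apply: wedgeZ => //; first by rewrite ltW// divr_gt0.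
by apply: rY; exact: ballxx.
Qed.

(** An additive norm N is linear on the cone, and this is a linear functional on
    all of X: Hahn-Banach is applied to the sublinear functional
    v |-> inf (N (v + a) - N a) over positive a. It is at most N, and
    taking [v = - x] and [a = x] for positive x shows that the resulting
    functional is at least N on the cone. *)
Lemma strictly_positive_functional (X : normedModType R) (Xp : set X)
    (N : X -> R) : is_wedge Xp -> is_norm N -> equivalent_norm N ->
  norm_additive_on Xp N ->
  exists2 phi : boundedOp X R^o, dual_wedge Xp phi &
    forall x, Xp x -> `|x| <= phi x.
Proof.
move=> wedgeX [ND NZ _] [c [C [c0 C0 NcC]]] NXp.
pose E := [set p : X * R | exists2 a, Xp a & N (p.1 + a) - N a <= p.2].
have N0 : N 0 = 0 by rewrite -(scale0r 0) NZ normr0 mul0r.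
have NN x : N (- x) = N x by rewrite -scaleN1r NZ normrN1 mul1r.
have NpZ b x : 0 < b -> N (b *: x) = b * N x by move=> b0; rewrite NZ gtr0_norm.
have Econe : epigraph_cone E.
  split.
  - by exists 0; [exact: wedge0|rewrite /= addr0 subrr].
  - move=> v w s t [a Xa /= av] [b Xb /= bw]; exists (a + b); first exact: wedgeD.
    rewrite /= addrACA (NXp a b)//; have := ND (v + a) (w + b); lra.
  - move=> b v s b0 [a Xa /= av]; exists (b *: a); first by apply: wedgeZ => //; exact: ltW.
    by rewrite /= -scalerDr !NpZ// -mulrBr ler_pM2l.
  - by move=> t [a Xa]; rewrite /= add0r subrr.
have [x|f fE] := hahn_banach _ Econe.
  by exists (N x), 0; [exact: wedge0|rewrite /= addr0 N0 subr0].
have fN x : f x <= N x.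
  by apply: fE; exists 0; [exact: wedge0|rewrite /= addr0 N0 subr0].
have fC x : f x <= C * `|x| by apply: le_trans (fN x) _; exact: (NcC x).2.
have Nf x : Xp x -> N x <= f x.
  move=> Xx; have : f (- x) <= - N x.
    by apply: fE; exists x => //=; rewrite addNr N0 sub0r.
  by rewrite linearN lerN2.
have f1 x : Xp x -> c * `|x| <= f x.
  by move=> Xx; apply: le_trans (Nf x Xx); exact: (NcC x).1.
exists (c^-1 *: op_of_dominated X f C fC).
  move=> x Xx; rewrite -[X in 0 <= X]/(c^-1 * f x) mulr_ge0//.
    by rewrite invr_ge0 ltW.
  by apply: le_trans (f1 x Xx); rewrite mulr_ge0// ltW.
by move=> x Xx; rewrite -[leRHS]/(c^-1 * f x) ler_pdivlMl// f1.
Qed.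

Lemma closed_order_unit (Y : normedModType R) (Yp : set Y) (e y : Y) :
  closed Yp -> e != 0 -> (forall eps : R, 0 < eps -> Yp (eps *: e + y)) -> Yp y.
Proof.
move=> closedY e0 Yy; apply: closedY => B /nbhs_ballP[r /= r0 rB].
have e0' : 0 < `|e| by rewrite normr_gt0.
pose c := r / 2 / `|e|.
have c0 : 0 < c by rewrite !divr_gt0.
exists (c *: e + y); split; first exact: Yy.
apply: rB; rewrite -ball_normE /= opprD addrC subrK normrN normrZ.
by rewrite gtr0_norm// divfK ?gt_eqF// ltr_pdivrMr// mulr_natr mulr2n ltrDl.
Qed.

(** The functional dominated by v |-> inf of the t with v <= t e is positive; since
    the cone is closed, that infimum is positive at [- y]. *)
Lemma positive_separation (Y : normedModType R) (Yp : set Y) (e y : Y) :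
  is_ordered_normed_space Yp -> (forall v, Yp (`|v| *: e - v)) -> Yp e -> ~ Yp y ->
  exists2 y' : boundedOp Y R^o, dual_wedge Yp y' & y' y < 0.
Proof.
move=> [coneY closedY] unit Ype Ny; have wedgeY := coneY.1.
pose E := [set p : Y * R | Yp (p.2 *: e - p.1)].
have e0 : e != 0.
  apply/eqP => e0; apply: Ny; have := unit (- y).
  by rewrite e0 scaler0 sub0r opprK.
have Econe : epigraph_cone E.
  split.
  - by rewrite /E/= scale0r subr0; exact: wedge0.
  - by move=> v w s t Ev Ew; rewrite /E/= scalerDl opprD addrACA; exact: wedgeD.
  - by move=> a v s a0 Ev; rewrite /E/= -scalerA -scalerBr; apply: wedgeZ (ltW _) _.
  - by move=> t; rewrite /E/= subr0; exact: (cone_scale_ge0 _ e).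
have [c c0 Nc] : exists2 c, 0 < c & ~ Yp (c *: e + y).
  apply: contrapT => /forall2NP H; apply: Ny; apply: (closed_order_unit _ _ e) => //.
  by move=> c c0; case: (H c) => // /contrapT.
have [v|t|g [gE gy]] := hahn_banach_lt _ (- y) c Econe.
- by exists `|v|; exact: unit.
- rewrite /E /= opprK => Et; rewrite leNgt; apply/negP => tc; apply: Nc.
  rewrite -[c](subrK t) scalerDl -addrA; apply: wedgeD => //.
  by apply: wedgeZ => //; rewrite subr_ge0 ltW.
have gM v : g v <= 1 * `|v| by rewrite mul1r; apply: gE; exact: unit.
exists (op_of_dominated Y g 1 gM) => [v Yv|].
  rewrite -oppr_le0 -linearN /=; apply: gE.
  by rewrite /E/= scale0r sub0r opprK.
by rewrite -oppr_gt0 -linearN /= (lt_le_trans c0).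
Qed.

(** In presence of an order unit u for a seminorm N, positive functionals are
    automatically bounded. *)
Lemma positive_le_order_unit (V : lmodType R) (K : set V) (N : V -> R) (u : V)
    (g : {linear V -> R^o}) : (forall v, K (N v *: u - v)) ->
  (forall v, K v -> 0 <= g v) -> forall v, g v <= g u * N v.
Proof.
by move=> Ku g0 v; have := g0 _ (Ku v); rewrite linearB linearZ /= subr_ge0 mulrC.
Qed.

End functionals.

(** * Finite rank operators *)

Section finite_rank_operators.
Context {R : realType} {X Y : normedModType R}.
Implicit Types (f : boundedOp X R^o) (g : boundedOp Y R^o) (T : boundedOp X Y).

Fact rank_one_bounded f (y : Y) :
  (fun x => f x *: y) \in @bounded_linear_pred R X Y.
Proof.
apply/asboolP; split=> [a u v|].
  by rewrite linearP scalerDl scalerA.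
exists (opnorm f * `|y|) => x; rewrite normrZ mulrAC ler_wpM2r//.
exact: (opnormP f x).
Qed.

Definition rank_one f y : boundedOp X Y := BoundedOp (rank_one_bounded f y).

Fact rank_one_approximable f y : rank_one f y \in @approximable_pred R X Y.
Proof.
rewrite !inE; apply: subset_closure; exists [set y]; split; first exact: finite_set1.
move=> _ [x _ <-]; exists 1, (fun=> f x), (fun=> y).
by split=> //; rewrite big_ord1.
Qed.

Definition tensor f y : approximableOp X Y :=
  ApproximableOp (rank_one_approximable f y).

Lemma tensorP f : linear (tensor f).
Proof.
move=> a y z; apply/val_inj/val_inj/funext => x.
by rewrite -[RHS]/(a *: (f x *: y) + f x *: z) /= scalerDr !scalerA mulrC.
Qed.

Lemma tensor_linearl y : linear (fun f : dual_space X => tensor f y).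
Proof.
move=> a f g; apply/val_inj/val_inj/funext => x.
by rewrite -[RHS]/(a *: (f x *: y) + g x *: y) scalerA -scalerDl.
Qed.

Fact functional_comp_bounded g T :
  (fun x => g (T x)) \in @bounded_linear_pred R X R^o.
Proof.
apply/asboolP; split=> [a u v|]; first by rewrite !linearP.
exists (opnorm g * opnorm T) => x; rewrite -mulrA.
by apply: (le_trans (opnormP g _)); rewrite ler_wpM2l ?opnorm_ge0// opnormP.
Qed.

Definition functional_comp g T : boundedOp X R^o :=
  BoundedOp (functional_comp_bounded g T).

(** Linear combinations of a list, arranged so that induction on the list peels
    off one generator at a time. *)
Fixpoint seq_span (s : seq Y) (v : Y) : Prop :=
  if s is u :: s' then exists a : R, seq_span s' (v - a *: u) else v = 0.

Lemma seq_span_lin s (a : R) v w : 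
  seq_span s v -> seq_span s w -> seq_span s (a *: v + w).
Proof.
elim: s v w => [|u s IH] v w /=; first by move=> -> ->; rewrite scaler0 addr0.
move=> [b vb] [c wc]; exists (a * b + c).
by rewrite scalerDl opprD addrACA -scalerA -scalerBr; exact: IH.
Qed.

Lemma seq_span0 s : seq_span s 0.
Proof.
by elim: s => //= u s IH; exists 0; rewrite scale0r subr0.
Qed.

Lemma seq_span_mem s v : v \in s -> seq_span s v.
Proof.
elim: s => //= u s IH; rewrite in_cons => /predU1P[->|/IH vs].
  by exists 1; rewrite scale1r subrr; exact: seq_span0.
by exists 0; rewrite scale0r subr0.
Qed.

Lemma linear_span_seq s : linear_span [set` s] `<=` seq_span s.
Proof.
move=> _ [n [a [u [us ->]]]].
elim/big_ind: _ => [|v w vs ws|i _]; first exact: seq_span0.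
  by rewrite -[v]scale1r; exact: seq_span_lin.
rewrite -[_ *: _]addr0; apply: seq_span_lin; last exact: seq_span0.
exact/seq_span_mem/us.
Qed.

Lemma seq_span_map (P : {linear Y -> Y}) s v :
  seq_span s v -> seq_span (map P s) (P v).
Proof.
elim: s v => [|u s IH] v /=; first by move=> ->; rewrite linear0.
by move=> [a /IH]; rewrite linearB linearZ; exists a.
Qed.

(** Splitting off from T the rank one operator x |-> g (T x) w, where w is in the
    range of T and g w = 1, leaves an operator with values in the image of the
    range under the projection along w. The rank drops, and the coefficient
    functionals are compositions with T, so they are bounded without any
    appeal to norms on finite dimensional spaces. *)
Lemma finite_rank_sum T :
  (forall y : Y, y != 0 -> exists g, g y != 0) ->
  @finite_rank R X Y T ->
  exists l : seq (boundedOp X R^o * Y),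
    T = \sum_(p <- l) rank_one p.1 p.2.
Proof.
move=> separating [B [/finite_seqP[s ->]] Ts].
have {Ts}: forall x, seq_span s (T x).
  by move=> x; apply: linear_span_seq; apply: Ts; exists x.
have [n sn] := ubnP (size s).
elim: n s T sn => // n IH [|u s] T /= sn Ts.
  exists [::]; rewrite big_nil; apply/val_inj/funext => x; exact: Ts.
have [/IH|/existsNP[x0 Tx0]] := pselect (forall x, seq_span s (T x)); first exact.
set w := T x0 in Tx0.
have w0 : w != 0 by apply/eqP => w0; apply: Tx0; rewrite w0; exact: seq_span0.
have [g0 g0w] := separating _ w0.
pose g := (g0 w)^-1 *: g0.
have gw : g w = 1 by rewrite -[LHS]/((g0 w)^-1 * g0 w) mulVf.
pose P y := y - g y *: w.
have Plin : linear P.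
  by move=> a y z; rewrite /P linearP scalerDl opprD addrACA -scalerA -scalerBr.
pose PL := HB.pack_for {linear Y -> Y} P (GRing.isLinear.Build R Y Y _ _ Plin).
have Pw : P w = 0 by rewrite /P gw scale1r subrr.
pose T1 := T - rank_one (functional_comp g T) w.
have T1x x : T1 x = P (T x) by [].
have [a wa] := Ts x0; rewrite -/w in wa.
have a0 : a != 0.
  by apply/eqP => a0; apply: Tx0; rewrite a0 scale0r subr0 in wa.
have T1s x : seq_span (map PL s) (T1 x).
  have [b Tb] := Ts x.
  (* Since P w = 0 and w - a u is in the span of s, P u is in that of P s. *)
  have -> : T1 x = PL ((- (b / a)) *: (w - a *: u) + (T x - b *: u)).
    rewrite scalerBr scalerA mulNr divfK// !scaleNr opprK.
    rewrite addrACA subrr addr0 linearD linearN linearZ /=.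
    by rewrite Pw scaler0 oppr0 add0r.
  by apply: seq_span_map; exact: seq_span_lin.
have [|l lE] := IH (map PL s) T1 _ T1s; first by rewrite size_map.
exists ((functional_comp g T, w) :: l).
by rewrite big_cons -lE /T1 addrC subrK.
Qed.

End finite_rank_operators.

(** * Separation form of approximate interpolation *)

Section interpolation_duality.
Context {R : realType} {V W : lmodType R} (K : set V) (L : set W).
Variables (ev : {linear V -> W}) (e : W).
Hypotheses (wedgeK : is_wedge K) (wedgeL : is_wedge L).
Hypothesis ev_pos : forall v, K v -> L (ev v).
Hypothesis K_generating : forall v, exists2 u, K u & K (u - v).
Hypothesis Le : L e.
Hypothesis e_unit : forall w, exists t, L (t *: e - w).
Hypothesis e_scale : forall t, L (t *: e) -> 0 <= t.

(** Hahn-Banach on V * V * W for the sublinear functional that sends (p, q, w) to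
    the infimum of the t such that some v above p and q satisfies
    ev v + w <= t e. The three components of the functional are positive, and
    on (v, v, - ev v) the whole functional vanishes, so the first two add up
    to the third composed with ev: this is why g is dominated by h after
    evaluation and why the component at b is h (ev b) - g b. *)
Lemma interpolation_duality a b y (eps : R) :
  (forall v, K (v - a) -> K (v - b) -> ~ L (y + eps *: e - ev v)) ->
  exists (g : {linear V -> R^o}) (h : {linear W -> R^o}),
    [/\ forall v, K v -> 0 <= g v, forall v, K v -> g v <= h (ev v) &
        eps <= g a + (h (ev b) - g b) - h y].
Proof.
move=> noint.
pose E : set ((V * V * W) * R) := [set p | exists v,
  [/\ K (v - p.1.1.1), K (v - p.1.1.2) & L (p.2 *: e - p.1.2 - ev v)]].
have Econe : epigraph_cone E.
  split.
  - exists 0; rewrite /= (linear0 ev) scale0r !subr0.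
    by split=> //; exact: wedge0.
  - move=> [[p q] w] [[p' q'] w'] s t [v [/= vp vq vw]] [v' [/= vp' vq' vw']].
    exists (v + v') => /=; split.
    + by rewrite opprD addrACA; exact: wedgeD.
    + by rewrite opprD addrACA; exact: wedgeD.
    + have := wedgeD _ _ wedgeL vw vw'.
      by rewrite addrACA (addrACA (s *: e)) -!opprD -scalerDl -linearD.
  - move=> c [[p q] w] s c0 [v [/= vp vq vw]]; exists (c *: v) => /=.
    have -> : ev (c *: v) = c *: ev v by rewrite linearZ.
    rewrite -scalerA -!scalerBr.
    by split; apply: wedgeZ => //; exact: ltW.
  - move=> t [v [/=]]; rewrite !subr0 => vK _ tev; apply: e_scale.
    by rewrite -[_ *: e](subrK (ev v)); apply: wedgeD => //; exact: ev_pos.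
have Etot u : exists t, E (u, t).
  case: u => [[p q] w].
  have [p1 p1K p1p] := K_generating p; have [q1 q1K q1q] := K_generating q.
  have [t tE] := e_unit (w + ev (p1 + q1)).
  (* A common upper bound of p and q exists as K is generating. *)
  exists t, (p1 + q1); split=> /=.
  - by rewrite addrAC; exact: wedgeD.
  - by rewrite -addrA; exact: wedgeD.
  - by rewrite -addrA -opprD.
have [t [v [/= va vb vy]]|f [fE feps]] :=
    hahn_banach_lt E (a, b, - y) eps Econe Etot.
  rewrite leNgt; apply/negP => te; apply: (noint v) => //.
  have eps_t : L ((eps - t) *: e) by apply: wedgeZ; rewrite ?subr_ge0 ?ltW.
  have := wedgeD _ _ wedgeL vy eps_t; rewrite opprK addrAC [t *: e + y]addrC.
  by rewrite -(addrA y) -scalerDl [t + _]addrC subrK.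
have glin : linear (fun p : V => f (p, 0, 0)).
  move=> c p q; rewrite -linearP; congr (f _).
  by congr (_, _, _); rewrite /= scaler0 addr0.
have hlin : linear (fun w : W => f (0, 0, w)).
  move=> c w w'; rewrite -linearP; congr (f _).
  by congr (_, _, _); rewrite /= scaler0 addr0.
exists (HB.pack_for {linear V -> R^o} (fun p : V => f (p, 0, 0))
  (GRing.isLinear.Build R V R^o _ _ glin)).
exists (HB.pack_for {linear W -> R^o} (fun w : W => f (0, 0, w))
  (GRing.isLinear.Build R W R^o _ _ hlin)).
rewrite /=.
have f_split p q w : f (p, q, w) = f (p, 0, 0) + f (0, q, 0) + f (0, 0, w).
  by rewrite -!linearD; congr (f _); congr (_, _, _); rewrite /= ?addr0 ?add0r.
have f_ge0 p q : K p -> K q -> 0 <= f (p, q, 0).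
  move=> pK qK; rewrite -oppr_le0 -linearN; apply: fE; exists 0.
  rewrite /= !opprK !add0r (linear0 ev) scale0r add0r subr0; split=> //.
  exact: wedge0.
have f_diag_le v : f (v, v, - ev v) <= 0.
  apply: fE; exists v; rewrite /= subrr scale0r sub0r opprK subrr.
  by split; exact: wedge0.
have fN w : f (0, 0, - w) = - f (0, 0, w).
  by rewrite -linearN; congr (f _); congr (_, _, _); rewrite /= oppr0.
have f_diag v : f (v, 0, 0) + f (0, v, 0) = f (0, 0, ev v).
  have fd : f (v, v, - ev v) = 0.
    apply/eqP; rewrite eq_le f_diag_le -oppr_le0 -(linearN f).
    by have := f_diag_le (- v); rewrite (linearN ev).
  by apply/eqP; rewrite -subr_eq0 -fN -f_split fd.
split=> [v vK|v vK|].
- by apply: f_ge0 => //; exact: wedge0.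
- by rewrite -f_diag lerDl; apply: f_ge0 => //; exact: wedge0.
- by rewrite -fN -f_diag [f (b, 0, 0) + _]addrC addrK -f_split.
Qed.

End interpolation_duality.

(** * Extremal vectors and operators *)

Section interpolation.
Context {R : realType} {X Y : normedModType R} (Xp : set X) (Yp : set Y).
Variables (phi : boundedOp X R^o) (e : Y).
Hypothesis Y_ordered : is_ordered_normed_space Yp.
Hypothesis phi_pos : dual_wedge Xp phi.
Hypothesis phi_ge : forall x, Xp x -> `|x| <= phi x.
Hypothesis Ype : Yp e.
Hypothesis e_neq0 : e != 0.
Hypothesis e_unit : forall v, Yp (`|v| *: e - v).

Local Notation C := (approximableOp X Y).
Local Notation Cp := (@positive_approximable_operators R X Y Xp Yp).
Local Notation coneY := (proj1 Y_ordered).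
Local Notation wedgeY := (proj1 (proj1 Y_ordered)).
Local Coercion approximableOp_val : approximableOp >-> boundedOp.
Implicit Types (S T : C) (f : boundedOp X R^o) (v y : Y).

Lemma positive_opP T : Cp T <-> forall x, Xp x -> Yp (T x).
Proof.
split=> [Tp x Xx|Tp _ [x Xx <-]]; last exact: Tp.
by apply: Tp; exists x.
Qed.

(** phi (x) e is an order unit for the operator norm: T x <= |T x| e, and |T x| is
    at most |T| |x|, hence at most |T| phi x for positive x. *)
Lemma operator_order_unit T : Cp (`|(T : boundedOp X Y)| *: tensor phi e - T).
Proof.
apply/positive_opP => x Xx.
rewrite -[X in Yp X]/(`|(T : boundedOp X Y)| *: (phi x *: e) - T x).
rewrite -[X in X - _](subrK (`|T x| *: e)) -addrA; apply: (wedgeD _ _ wedgeY) => //.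
rewrite scalerA -scalerBl; apply: (wedgeZ _ _ wedgeY) => //; rewrite subr_ge0.
apply: le_trans (opnormP T x) _; rewrite ler_wpM2l//; first exact: opnorm_ge0.
exact: phi_ge.
Qed.

Lemma dual_order_unit f : dual_wedge Xp (`|f| *: phi - f).
Proof.
move=> x Xx; rewrite -[X in 0 <= X]/(`|f| * phi x - f x) subr_ge0.
apply: le_trans (ler_norm _) _; apply: le_trans (opnormP f x) _.
by rewrite ler_wpM2l//; [exact: opnorm_ge0|exact: phi_ge].
Qed.

Lemma positive_functional_separates y : y != 0 ->
  exists2 y' : boundedOp Y R^o, dual_wedge Yp y' & y' y != 0.
Proof.
move=> y0; have [Yy|Ny] := pselect (Yp y).
  have [|y' y'p y'y] := positive_separation Y Yp e (- y) Y_ordered e_unit Ype.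
    by move=> YNy; move/eqP: y0; apply; apply: (cone_anti _ coneY).
  exists y' => //; apply/eqP => y'y0; move: y'y.
  by rewrite linearN /= y'y0 oppr0 ltxx.
have [y' y'p y'y] := positive_separation Y Yp e y Y_ordered e_unit Ype Ny.
by exists y' => //; rewrite lt_eqF.
Qed.

Lemma tensor_pos f v : dual_wedge Xp f -> Yp v -> Cp (tensor f v).
Proof.
move=> fp Yv; apply/positive_opP => z Xz.
by apply: (wedgeZ _ _ wedgeY) => //; exact: fp.
Qed.

Section splitting.
Variables (x : X) (g : {linear C -> R^o}) (h : {linear Y -> R^o}).
Hypothesis Xx : Xp x.
Hypothesis x_neq0 : x != 0.
Hypothesis x_extremal :
  extremal (dual_wedge (dual_wedge Xp)) (bidual_embedding x).
Hypothesis g_ge0 : forall T, Cp T -> 0 <= g T.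
Hypothesis g_le : forall T, Cp T -> g T <= h (T x).

Let phix_gt0 : 0 < phi x.
Proof. by apply: lt_le_trans (phi_ge x Xx); rewrite normr_gt0. Qed.

(** The only candidate: g U = l (U x) with U = phi (x) v forces this value. *)
Definition splitting_functional v : R^o := g (tensor phi v) / phi x.

Lemma splitting_functional_linear : linear splitting_functional.
Proof.
move=> a v w; rewrite /splitting_functional tensorP linearP mulrDl.
by rewrite -[X in X + _]mulrA.
Qed.

HB.instance Definition _ := GRing.isLinear.Build R Y R^o _ splitting_functional
  splitting_functional_linear.

Lemma splitting_functional_ge0 v : Yp v -> 0 <= splitting_functional v.
Proof.
move=> Yv; rewrite divr_ge0 ?(ltW phix_gt0)//.
by apply: g_ge0; exact: tensor_pos.
Qed.

Lemma splitting_functional_le v : Yp v -> splitting_functional v <= h v.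
Proof.
move=> Yv; rewrite ler_pdivrMr// mulrC.
have := g_le _ (tensor_pos phi v phi_pos Yv).
by rewrite -[tensor phi v x]/(phi x *: v) linearZ.
Qed.

(** This is where extremality in the bidual enters: as a functional of f, g of
    f (x) v is positive and at most h v times evaluation at x. *)
Lemma splitting_tensor_pos f v : Yp v ->
  g (tensor f v) = splitting_functional v * f x.
Proof.
move=> Yv.
have hv1 : 0 < h v + 1.
  by rewrite ltr_wpDl// (le_trans (splitting_functional_ge0 v Yv))//
    splitting_functional_le.
pose G (f' : dual_space X) : R^o := g (tensor f' v).
have Glin : linear G by move=> a f1 f2; rewrite /G tensor_linearl linearP.
pose GL := HB.pack_for {linear dual_space X -> R^o} G
  (GRing.isLinear.Build R (dual_space X) R^o _ _ Glin).
have GM (f' : dual_space X) : GL f' <= GL phi * `|f'|.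
  apply: (positive_le_order_unit (dual_space X) (dual_wedge Xp)) => [f1|f1 f1p].
    exact: dual_order_unit.
  by apply: g_ge0; exact: tensor_pos.
(* Dividing by h v + 1 instead of h v avoids the case h v = 0 and still puts the
   functional below evaluation at x. *)
pose G' := (h v + 1)^-1 *: op_of_dominated (dual_space X) GL (GL phi) GM.
have [] := x_extremal => _ /(_ G') [].
  split=> f1 f1p.
    rewrite subr0 -[X in 0 <= X]/((h v + 1)^-1 * G f1) mulr_ge0//.
      by rewrite invr_ge0 ltW.
    by apply: g_ge0; exact: tensor_pos.
  rewrite -[X in 0 <= X]/(f1 x - (h v + 1)^-1 * G f1) subr_ge0 ler_pdivrMl//.
  apply: (le_trans (g_le _ (tensor_pos f1 v f1p Yv))).
  rewrite -[tensor f1 v x]/(f1 x *: v) linearZ /= -[_ *: _]/(f1 x * h v) mulrC.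
  by rewrite ler_wpM2r ?lerDl//; exact: f1p.
move=> a _ aG.
have GE f1 : g (tensor f1 v) = (h v + 1) * (a * f1 x).
  have -> : a * f1 x = G' f1 by rewrite -aG.
  by rewrite -[G' f1]/((h v + 1)^-1 * G f1) mulrA divff ?gt_eqF// mul1r.
rewrite /splitting_functional !GE !mulrA mulfK ?gt_eqF//.
Qed.

Lemma splitting_tensor f v : g (tensor f v) = splitting_functional v * f x.
Proof.
(* v is the difference of the positive vectors |v| e and |v| e - v. *)
rewrite -[v](subKr (`|v| *: e)).
have tB u w : tensor f (u - w) = tensor f u - tensor f w.
  by rewrite -scaleN1r addrC tensorP scaleN1r addrC.
have gB S T : g (S - T) = (g S : R) - g T by rewrite linearB.
have sB u w : splitting_functional (u - w) =
    (splitting_functional u : R) - splitting_functional w by rewrite linearB.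
rewrite tB gB sB mulrBl !splitting_tensor_pos//.
by apply: (wedgeZ _ _ wedgeY).
Qed.

Lemma splitting_finite_rank T : finite_rank (T : boundedOp X Y) ->
  g T = splitting_functional (T x).
Proof.
move=> /finite_rank_sum[y /positive_functional_separates[y' _ y'y]|l].
  by exists y'.
elim: l T => [|p l IH] T Tl.
  have -> : T = 0 by apply/val_inj; rewrite /= Tl big_nil.
  by rewrite linear0 -[(0 : C) x]/0 linear0.
rewrite -[T](subrK (tensor p.1 p.2)) linearD IH; last first.
  rewrite -[LHS]/((T : boundedOp X Y) - rank_one p.1 p.2) Tl big_cons.
  by rewrite addrC addKr.
rewrite splitting_tensor -[RHS]/(splitting_functional
  ((T - tensor p.1 p.2) x + p.1 x *: p.2)) [RHS]linearD; congr (_ + _).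
by rewrite linearZ [LHS]mulrC.
Qed.

(** Both sides are bounded functionals of T, because of the order units, and they
    agree on the dense subspace of finite rank operators. *)
Lemma splitting_approximable T : g T = splitting_functional (T x).
Proof.
pose D T : R := g T - splitting_functional (T x).
pose K : R := g (tensor phi e) + splitting_functional e * `|x|.
have K0 : 0 <= K.
  apply: addr_ge0; first by apply: g_ge0; exact: tensor_pos.
  by apply: mulr_ge0 => //; exact: splitting_functional_ge0.
have DK U : D U <= K * `|(U : boundedOp X Y)|.
  rewrite /D /K mulrDl; apply: lerD.
    exact: (positive_le_order_unit C Cp (fun U : C => `|(U : boundedOp X Y)|)
      _ _ operator_order_unit g_ge0).
  rewrite -linearN; apply: le_trans
    (positive_le_order_unit Y Yp Num.norm _ _ e_unit splitting_functional_ge0 _) _.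
  rewrite normrN -[leRHS]mulrA; apply: ler_wpM2l.
    exact: splitting_functional_ge0.
  by rewrite mulrC; exact: opnormP.
have DB U W : D (U - W) = D U - D W.
  have -> : D (U - W) = (g U - g W : R) -
      (splitting_functional (U x) - splitting_functional (W x)).
    by rewrite /D linearB -[(U - W) x]/(U x - W x) (linearB splitting_functional).
  by rewrite /D; ring.
have D0 U : D U <= 0.
  rewrite leNgt; apply/negP => DU.
  have K1 : 0 < K + 1 by rewrite ltr_wpDl.
  have : closure (@finite_rank R X Y) (U : boundedOp X Y).
    by apply: set_mem; exact: approximableOp_closure.
  move=> /(_ _ (nbhsx_ballx _ _ (divr_gt0 DU K1)))[S [fS]].
  rewrite -ball_normE /= => US.
  have SC : S \in @approximable_pred R X Y.
    by rewrite inE; exact: subset_closure.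
  have DS : D (ApproximableOp SC) = 0.
    by rewrite /D splitting_finite_rank// subrr.
  have := DK (U - ApproximableOp SC); rewrite DB DS subr0 leNgt => /negP; apply.
  apply: (@le_lt_trans _ _ ((K + 1) * `|(U : boundedOp X Y) - S|)).
    by rewrite ler_wpM2r// lerDl.
  by rewrite -ltr_pdivlMl// mulrC.
apply/eqP; rewrite -subr_eq0 eq_le D0/= -oppr_le0.
have D00 : D 0 = 0 by rewrite -(subrr 0) DB subrr.
by have := D0 (0 - T); rewrite DB D00 sub0r.
Qed.

Lemma extremal_splitting : exists l : {linear Y -> R^o},
  (forall T, g T = l (T x)) /\ forall v, Yp v -> 0 <= l v <= h v.
Proof.
exists splitting_functional; split=> [T|v Yv]; first exact: splitting_approximable.
by rewrite splitting_functional_ge0 ?splitting_functional_le.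
Qed.

End splitting.

Lemma positive_operators_wedge : is_wedge Cp.
Proof.
split; first by exists 0; apply/positive_opP => x _; exact: wedge0 wedgeY.
move=> a b S T a0 b0 /positive_opP Sp /positive_opP Tp; apply/positive_opP => x Xx.
rewrite -[X in Yp X]/(a *: S x + b *: T x).
by apply: wedgeY.2 => //; [exact: Sp|exact: Tp].
Qed.

Lemma evaluation_linear (x : X) : linear (fun T : C => T x).
Proof. by []. Qed.

(** If no such T existed, the separating functional of [interpolation_duality]
    would be at least eps > 0, while writing g U = l (U x) it equals
    - l (y - A x) - (h - l) (y - B x), which is at most 0. *)
Lemma extremal_interpolation (x : X) (A B : C) y (eps : R) : Xp x -> x != 0 ->
  extremal (dual_wedge (dual_wedge Xp)) (bidual_embedding x) ->
  Yp (y - A x) -> Yp (y - B x) -> 0 < eps ->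
  exists T, [/\ Cp (T - A), Cp (T - B) & Yp (y + eps *: e - T x)].
Proof.
move=> Xx x0 xext YA YB eps0; apply: contrapT => nT.
pose ev := HB.pack_for {linear C -> Y} (fun T : C => T x)
  (GRing.isLinear.Build R C Y _ _ (evaluation_linear x)).
have ev_pos T : Cp T -> Yp (ev T) by move=> /positive_opP; apply.
have generating T : exists2 U, Cp U & Cp (U - T).
  exists (`|(T : boundedOp X Y)| *: tensor phi e); last exact: operator_order_unit.
  apply: (wedgeZ _ _ positive_operators_wedge (opnorm_ge0 T)).
  exact: tensor_pos.
have e_absorbs v : exists t, Yp (t *: e - v) by exists `|v|.
have e_scale t : Yp (t *: e) -> 0 <= t by apply: (cone_scale_ge0 _ e coneY).
have [T TA TB yT|g [h [g_ge0 g_le]]] := interpolation_duality Cp Yp ev e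
    positive_operators_wedge wedgeY ev_pos generating Ype e_absorbs e_scale A B y eps.
  by apply: nT; exists T.
rewrite leNgt => /negP; apply; apply: le_lt_trans eps0.
have [l [gE l_itv]] := extremal_splitting x g h Xx x0 xext g_ge0 g_le.
have /andP[lA _] := l_itv _ YA; have /andP[_ lB] := l_itv _ YB.
rewrite !gE; move: lA lB; rewrite (linearB l) (linearB l) (linearB h).
move: (l y) (l (A x)) (l (B x)) (h y) (h (B x)) => a b c d i.
rewrite -/(ev B); lra.
Qed.

End interpolation.

(** * Disjointness *)

Section dense_extremals.
Context {R : realType} {X : normedModType R} (Xp : set X).
Hypothesis Xp_dense : Xp `<=` closure (convex_hull [set x | extremal Xp x]).

(** The half-space where f is non-negative is convex and closed, so it contains
    the closed convex hull of the extremal vectors. *)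
Lemma dual_wedge_extremal (f : boundedOp X R^o) :
  (forall x, extremal Xp x -> 0 <= f x) -> dual_wedge Xp f.
Proof.
move=> f0 x /Xp_dense xcl; rewrite leNgt; apply/negP => fx.
have n1 : 0 < opnorm f + 1 by rewrite ltr_wpDl ?opnorm_ge0.
have r0 : 0 < - f x / (opnorm f + 1) by rewrite divr_gt0 ?oppr_gt0.
have [z [zhull]] := xcl _ (nbhsx_ballx _ _ r0).
rewrite -ball_normE /= ltr_pdivlMr// mulrC => xz.
have fz : 0 <= f z.
  suff halfspace_convex : convex_set ([set z | 0 <= f z] : set (convex_lmodType X)).
    exact: (smallest_sub halfspace_convex f0 zhull).
  move=> u v t; rewrite !inE /= => fu fv.
  rewrite -[conv t u v]/(t%:num *: (u : X) + (1 - t%:num) *: (v : X)).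
  rewrite linearD !linearZ /=; apply: addr_ge0; apply: mulr_ge0 => //.
have fB : f z - f x <= opnorm f * `|x - z|.
  by rewrite distrC -linearB (le_trans (ler_norm _))// opnormP.
suff : f z - f x < - f x by rewrite gtrDr ltNge fz.
apply: le_lt_trans fB _; apply: le_lt_trans xz.
by rewrite ler_wpM2r// lerDl.
Qed.

(** At an extremal vector f1 + f2 and f1 - f2 agree up to sign, and upper bounds in
    X' are recognised on extremal vectors. *)
Lemma disjoint_of_vanishing_on_extremals (f1 f2 : boundedOp X R^o) :
  (forall x, extremal Xp x -> f1 x = 0 \/ f2 x = 0) ->
  @disjoint_elements R (dual_space X) (dual_wedge Xp) f1 f2.
Proof.
move=> f12; apply: disjoint_sub => f2' w f2'E /= w1 w2.
have {}f12 x : extremal Xp x -> f1 x = 0 \/ f2' x = 0.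
  move=> /f12[->|fx]; [by left|right].
  by case: f2'E => ->; rewrite // -[LHS]/(- f2 x) fx oppr0.
split; apply: dual_wedge_extremal => x xext; have := w1 _ xext.1;
  have := w2 _ xext.1; rewrite -[(w + _) x]/(w x + (f1 x + f2' x))
    -[(w - (f1 + _)) x]/(w x - (f1 x + f2' x)).
- rewrite -[(w - _) x]/(w x - (f1 x - f2' x)).
  by case: (f12 x xext) => ->; rewrite ?subr0 ?addr0 ?sub0r ?add0r ?opprK.
- rewrite -[(w + _) x]/(w x + (f1 x - f2' x)).
  by case: (f12 x xext) => ->; rewrite ?subr0 ?addr0 ?sub0r ?add0r.
Qed.

End dense_extremals.

Lemma dual_wedge_wedge {R : realType} {X : normedModType R} (Xp : set X) :
  is_wedge (dual_wedge Xp).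
Proof.
split=> [|a b f g a0 b0 fp gp x Xx].
  by exists 0 => x Xx; exact: lexx.
rewrite -[X in 0 <= X]/(a * f x + b * g x).
by apply: addr_ge0; apply: mulr_ge0 => //; [exact: fp|exact: gp].
Qed.

Lemma total_cone_nonzero {R : realType} {X : normedModType R} (Xp : set X) :
  (exists x : X, x != 0) -> total_cone Xp -> exists2 x, Xp x & x != 0.
Proof.
move=> [x x0] Xp_total; apply: contrapT => /forall2NP Xp0.
have nx0 : 0 < `|x| by rewrite normr_gt0.
have [|v [xv [n [a [u [uXp vE]]]]]] := Xp_total (ball x `|x|) _ (ball_open _ _).
  by exists x; exact: ballxx.
move: xv; rewrite vE -ball_normE /= big1 ?subr0 ?ltxx// => i _.
have [/(_ (uXp i))//|/negP] := Xp0 (u i).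
by rewrite negbK => /eqP ->; rewrite scaler0.
Qed.

Section disjoint_operators.
Context {R : realType} {X Y : normedModType R} (Xp : set X) (Yp : set Y).
Variables (phi : boundedOp X R^o) (e : Y).
Hypothesis Y_ordered : is_ordered_normed_space Yp.
Hypothesis phi_pos : dual_wedge Xp phi.
Hypothesis phi_ge : forall x, Xp x -> `|x| <= phi x.
Hypothesis Ype : Yp e.
Hypothesis e_neq0 : e != 0.
Hypothesis e_unit : forall v, Yp (`|v| *: e - v).

Local Notation Cp := (@positive_approximable_operators R X Y Xp Yp).
Local Coercion approximableOp_val : approximableOp >-> boundedOp.
Implicit Types S T : approximableOp X Y.

(** Given an upper bound w in Y, interpolation supplies an upper bound U in the
    space of operators with U x <= w + eps e; disjointness of S and T
    transfers U, and eps tends to 0. *)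
Lemma disjoint_at_extremal S T (x : X) : Xp x -> x != 0 ->
  extremal (dual_wedge (dual_wedge Xp)) (bidual_embedding x) ->
  disjoint_elements Cp S T -> disjoint_elements Yp (S x) (T x).
Proof.
move=> Xx x0 xext /disjointP ST.
have [[wedgeY _] closedY] := Y_ordered.
apply: disjoint_sub => y w yE w1 w2.
have {ST yE}[T' yT ST'] : exists2 T' : approximableOp X Y, y = T' x &
    forall U : approximableOp X Y, Cp (U - (S + T')) -> Cp (U + (S + T')) ->
    Cp (U - (S - T')) /\ Cp (U + (S - T')).
  case: yE => ->; first by exists T => // U U1 U2; apply/ST.
  exists (- T) => // U U1 U2; rewrite opprK.
  exact: ((ST U).2 (conj U1 U2)).
rewrite {y}yT in w1 w2 *.
have interp (eps : R) : 0 < eps -> exists U : approximableOp X Y,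
    [/\ Cp (U - (S - T')), Cp (U + (S - T')) & Yp (w + eps *: e - U x)].
  move=> eps0; have w2' : Yp (w - (- (S + T')) x).
    by rewrite -[X in Yp (_ - X)]/(- (S x + T' x)) opprK.
  have [U [U1 U2 Uw]] := extremal_interpolation Xp Yp phi e Y_ordered phi_pos
    phi_ge Ype e_neq0 e_unit x (S + T') (- (S + T')) w eps Xx x0 xext w1 w2' eps0.
  rewrite opprK in U2; have [U3 U4] := ST' U U1 U2.
  by exists U.
split; apply: (closed_order_unit _ _ e) => // eps;
  move=> /interp[U [/positive_opP U1 /positive_opP U2 Uw]].
  have := wedgeD _ _ wedgeY Uw (U1 x Xx).
  rewrite -[(U - _) x]/(U x - (S x - T' x)) addrA subrK.
  by rewrite -addrA addrCA.
have := wedgeD _ _ wedgeY Uw (U2 x Xx).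
rewrite -[(U + _) x]/(U x + (S x - T' x)) addrA subrK.
by rewrite -addrA addrCA.
Qed.

Lemma positive_operator_dual U : Cp U <->
  forall y', dual_wedge Yp y' -> dual_wedge Xp (functional_comp y' U).
Proof.
split=> [/positive_opP Up y' y'p x Xx|Uy']; first by apply: y'p; exact: Up.
apply/positive_opP => x Xx; apply: contrapT.
move=> /(positive_separation _ _ _ _ Y_ordered e_unit Ype)[y' y'p].
by rewrite ltNge => /negP; apply; exact: (Uy' y' y'p x Xx).
Qed.

(** Composition with a positive functional y' turns bounds on f (x) y into bounds
    on y' y times f in X', and all these together recover the operator bound. *)
Lemma tensor_disjointl (f1 f2 : boundedOp X R^o) (y : Y) : 
   @disjoint_elements R (dual_space X) (dual_wedge Xp) f1 f2 ->
  disjoint_elements Cp (tensor f1 y) (tensor f2 y).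
Proof.
move=> f12; apply/disjointP => W.
have compE (y' : boundedOp Y R^o) (h : dual_space X) (b : R) :
    functional_comp y' (W + b *: tensor h y) =
    functional_comp y' W + b *: (y' y *: h) :> dual_space X.
  apply/val_inj/funext => x.
  rewrite -[RHS]/(y' (W x) + b * (y' y * h x)) [y' y * h x]mulrC.
  by rewrite -[LHS]/(y' (W x + b *: (h x *: y))) linearD !linearZ.
have boundE (h : dual_space X) :
    Cp (W - tensor h y) /\ Cp (W + tensor h y) <->
    forall y', dual_wedge Yp y' ->
      dual_wedge Xp (functional_comp y' W - y' y *: h : dual_space X) /\
      dual_wedge Xp (functional_comp y' W + y' y *: h : dual_space X).
  have compD y' : functional_comp y' (W + tensor h y) =
      functional_comp y' W + y' y *: h :> dual_space X.
    by have := compE y' h 1; rewrite !scale1r.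
  have compB y' : functional_comp y' (W - tensor h y) =
      functional_comp y' W - y' y *: h :> dual_space X.
    by have := compE y' h (- 1); rewrite !scaleN1r.
  split=> [[W1 W2] y' y'p|W12].
    rewrite -compD -compB.
    by split; [exact: (positive_operator_dual _).1 W1 _ y'p
              |exact: (positive_operator_dual _).1 W2 _ y'p].
  by split; apply/positive_operator_dual => y' /W12[]; rewrite -compB -compD.
have tensorD : tensor f1 y + tensor f2 y = tensor (f1 + f2) y.
  by have := tensor_linearl y 1 f1 f2; rewrite !scale1r.
have tensorB : tensor f1 y - tensor f2 y = tensor (f1 - f2) y.
  by have := tensor_linearl y (- 1) f2 f1; rewrite !scaleN1r ![- _ + _]addrC.
rewrite tensorD tensorB !boundE.
have f12y (y' : boundedOp Y R^o) := (disjointP _ _).1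
  (disjointZ (y' y) f1 f2 (dual_wedge_wedge Xp) f12) (functional_comp y' W).
by split=> W12 y' /W12; have := f12y y'; rewrite -scalerDr -scalerBr => -[].
Qed.

Lemma tensor_disjointr f (y1 y2 : Y) :
  disjoint_elements Yp y1 y2 -> disjoint_elements Cp (tensor f y1) (tensor f y2).
Proof.
move=> y12; have [[wedgeY _] _] := Y_ordered.
apply/disjointP => W.
have y12x x := (disjointP _ _).1 (disjointZ (f x) y1 y2 wedgeY y12) (W x).
split=> -[/positive_opP W1 /positive_opP W2]; split; apply/positive_opP => x Xx;
  have := conj (W1 x Xx) (W2 x Xx).
- by move=> /(y12x x).1[].
- by move=> /(y12x x).1[].
- by move=> /(y12x x).2[].
- by move=> /(y12x x).2[].
Qed.

End disjoint_operators.

Theorem corollary6p7 (R : realType) (X Y : normedModType R)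
    (Xp : set X) (Yp : set Y)
    (X_neq0 : exists x : X, x != 0) (Y_neq0 : exists y : Y, y != 0)
    (X_ordered : is_ordered_normed_space Xp)
    (Y_ordered : is_ordered_normed_space Yp)
    (Xp_total : total_cone Xp)
    (Xp_additive : exists N : X -> R,
      [/\ is_norm N, equivalent_norm N & norm_additive_on Xp N])
    (Xp_extremal : forall x : X, extremal Xp x ->
      extremal (dual_wedge (dual_wedge Xp)) (bidual_embedding x))
    (Xp_dense : Xp `<=` closure (convex_hull [set x | extremal Xp x]))
    (Yp_interior : interior Yp !=set0) :
  ~ has_nonzero_disjoint_pair (positive_approximable_operators Xp Yp) <->
  ~ has_nonzero_disjoint_pair (dual_wedge Xp) /\
  ~ has_nonzero_disjoint_pair Yp.
Proof.
have wedgeX := X_ordered.1.1; have coneY := Y_ordered.1.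
have [e Ype e_unit] := norm_order_unit Y Yp coneY.1 Yp_interior.
have e_neq0 : e != 0.
  have [y y0] := Y_neq0; apply/eqP => e0; move/eqP: y0; apply.
  apply: (cone_anti _ coneY).
    by have := e_unit (- y); rewrite e0 scaler0 sub0r opprK.
  by have := e_unit y; rewrite e0 scaler0 sub0r.
have [N [N_norm N_equiv N_add]] := Xp_additive.
have [phi phi_pos phi_ge] :=
  strictly_positive_functional X Xp N wedgeX N_norm N_equiv N_add.
have [x0 Xx0 x0_neq0] := total_cone_nonzero Xp X_neq0 Xp_total.
have separating := positive_functional_separates Yp e Y_ordered Ype e_unit.
split=> [noC|[noX' noY] [S [T [S0 T0 ST]]]].
  split=> [[f1 [f2 [f10 f20 f12]]]|[y1 [y2 [y10 y20 y12]]]]; apply: noC.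
    have tensor_e_neq0 (f : dual_space X) : f != 0 -> tensor f e != 0.
      apply: contra_neq => fe; apply/val_inj/funext => x.
      have : (f : boundedOp X R^o) x *: e = 0.
        by rewrite -[LHS]/(approximableOp_val (tensor f e) x) fe.
      by move=> /eqP; rewrite scaler_eq0 (negbTE e_neq0) orbF => /eqP.
    exists (tensor f1 e), (tensor f2 e); split; [exact: tensor_e_neq0..|].
    exact: (tensor_disjointl Xp Yp e).
  have phix0 : phi x0 != 0.
    by rewrite gt_eqF// (lt_le_trans _ (phi_ge x0 Xx0))// normr_gt0.
  have phi_tensor_neq0 y : y != 0 -> tensor phi y != 0.
    apply: contra_neq => phiy; apply/eqP.
    rewrite -[_ == _]orFb -(negbTE phix0) -scaler_eq0.
    by rewrite -[X in X == _]/(approximableOp_val (tensor phi y) x0) phiy.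
  exists (tensor phi y1), (tensor phi y2); split; [exact: phi_tensor_neq0..|].
  exact: tensor_disjointr.
have ST_extremal x : extremal Xp x ->
    approximableOp_val S x = 0 \/ approximableOp_val T x = 0.
  move=> xext; have [->|xn0] := eqVneq x 0; first by left; rewrite linear0.
  have STx := disjoint_at_extremal Xp Yp phi e Y_ordered phi_pos phi_ge Ype e_neq0
    e_unit S T x xext.1 xn0 (Xp_extremal x xext) ST.
  apply: contrapT => /not_orP[/eqP Sx /eqP Tx]; apply: noY.
  by exists (approximableOp_val S x), (approximableOp_val T x).
have detect (U : approximableOp X Y) : U != 0 -> exists y' : boundedOp Y R^o,
    functional_comp y' (approximableOp_val U) != 0 :> dual_space X.
  move=> U0; have [x Ux] : exists x, approximableOp_val U x != 0.
    apply: contrapT => /forallNP Ux; move/eqP: U0; apply.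
    apply/val_inj/val_inj/funext => x.
    by have /negP := Ux x; rewrite negbK => /eqP.
  have [y' _ y'Ux] := separating _ Ux.
  by exists y'; apply: contra_neq y'Ux => /(congr1 (fun f : boundedOp X R^o => f x)).
have [y1' S'0] := detect S S0; have [y2' T'0] := detect T T0.
apply: noX'.
exists (functional_comp y1' (approximableOp_val S)),
  (functional_comp y2' (approximableOp_val T)); split=> //.
apply: disjoint_of_vanishing_on_extremals => // x /ST_extremal[Sx|Tx].
  by left; rewrite /= Sx linear0.
by right; rewrite /= Tx linear0.
Qed.
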